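(* Let $(n-m,m)\in\mathcal{P}_n$. Then the zonal polynomial coefficient $c_{(n),(n-m,m)}$ is given by $$c_{(n),(n-m,m)}=\binom{n}{m}\cdot\frac{\left(\frac12\right)_m}{\left(n-m+\frac12\right)_m}.$$
   Context: Pochhammer symbol: $(a)_m:=a(a+1)\cdots(a+m-1)$. Partitions: $\mathcal{P}_n$ is the set of integer partitions of $n$, i.e. tuples $\lambda=(\lambda_1,\ldots,\lambda_k)$ of integers with $\lambda_1\ge\cdots\ge\lambda_k\ge 1$ and $\lambda_1+\cdots+\lambda_k=n$. They are ordered lexicographically: $\kappa>\lambda$ iff for some $l$ one has $\kappa_1=\lambda_1,\ldots,\kappa_{l-1}=\lambda_{l-1}$ and $\kappa_l>\lambda_l$. Put $\rho_\lambda:=\sum_{i=1}^{k}\lambda_i(\lambda_i-i)$. Monomial symmetric functions: for $\lambda\in\mathcal{P}_n$ and variables $y_1,\ldots,y_q$, $M_\lambda(y_1,\ldots,y_q)$ is the sum of all distinct monomials obtained from $y_1^{\lambda_1}\cdots y_k^{\lambda_k}$ by permuting the variables (and $M_\lambda=0$ if $q<k$). Zonal polynomials and their coefficients: take $q\geq n$ variables $y_1,\dots,y_q$ (the coefficients do not depend on $q$). The zonal polynomials $\mathcal{C}_\kappa$, $\kappa\in\mathcal{P}_n$, are the symmetric homogeneous polynomials of degree $n$ of the form $\mathcal{C}_\kappa=\sum_{\lambda\le\kappa}c_{\kappa,\lambda}M_\lambda$ (with $c_{\kappa,\lambda}=0$ for $\lambda<\kappa$ with $\rho_\kappa\le\rho_\lambda$)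 that are eigenfunctions $$\Delta_Y\,\mathcal{C}_\kappa=(\rho_\kappa+(q-1)n)\,\mathcal{C}_\kappa,\qquad \Delta_Y=\sum_{i=1}^{q}\Big(y_i^2\frac{\partial^2}{\partial y_i^2}+\sum_{j\ne i}\frac{y_i^2}{y_i-y_j}\frac{\partial}{\partial y_i}\Big),$$ normalized by $\sum_{\kappa\in\mathcal{P}_n}\mathcal{C}_\kappa=(y_1+\cdots+y_q)^n$. The numbers $c_{\kappa,\lambda}$ are the zonal polynomial coefficients (with $c_{\kappa,\lambda}=0$ for $\lambda>\kappa$). Equivalently, the $c_{\kappa,\lambda}$ are determined recursively as follows. For $\lambda<\kappa$ with $\rho_\kappa>\rho_\lambda$, $$c_{\kappa,\lambda}=\sum_{(r,s,t)}\frac{(\lambda_r+t)-(\lambda_s-t)}{\rho_\kappa-\rho_\lambda}\,c_{\kappa,\mu},$$ the sum being over all $r<s$ and $1\le t\le\lambda_s$ such that the partition $\mu$, obtained from $\lambda$ by replacing $\lambda_r$ by $\lambda_r+t$ and $\lambda_s$ by $\lambda_s-t$ and sorting in descending order (dropping zeros), satisfies $\lambda<\mu\le\kappa$. For $\lambda<\kappa$ with $\rho_\kappa\le\rho_\lambda$, $c_{\kappa,\lambda}=0$. The diagonal entries are determined by $\sum_{\kappa\ge\lambda}c_{\kappa,\lambda}=\frac{n!}{\lambda_1!\cdots\lambda_k!}$ for every $\lambda\in\mathcal{P}_n$; in particular $c_{(n),(n)}=1$. *)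

(* Defs.v *)
From HB Require Import structures.
From mathcomp Require Import all_boot all_order all_algebra.
From mathcomp Require Import mpoly.

Set Implicit Arguments.
Unset Strict Implicit.
Unset Printing Implicit Defensive.

Import Order.TTheory GRing.Theory Num.Theory.
Local Open Scope ring_scope.

Definition pochhammer (R : pzRingType) (a : R) (m : nat) : R :=
  \prod_(i < m) (a + i%:R).

Definition is_partition (n : nat) (s : seq nat) : bool :=
  [&& sorted geq s, all (fun p => 0 < p)%N s & sumn s == n].

(* A partition of n has at most n parts, each at most n; see mem_partitions. *)
Definition partitions (n : nat) : seq (seq nat) :=
  [seq s <- [seq map val (val t) | t <- enum {: n.-bseq 'I_n.+1}]
     | is_partition n s].

Lemma partitions_uniq n : uniq (partitions n).
Proof.
rewrite filter_uniq // map_inj_uniq ?enum_uniq // => s t /= eq_st.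
exact/val_inj/(inj_map val_inj).
Qed.

Lemma mem_partitions n s : (s \in partitions n) = is_partition n s.
Proof.
rewrite mem_filter andb_idr // => /and3P [_ s_gt0 /eqP s_sum].
have le_size : (size s <= n)%N.
  rewrite -s_sum; elim: s s_gt0 {s_sum} => //= x s IHs /andP [x_gt0 s_gt0].
  by rewrite -add1n leq_add ?IHs.
have le_part x : x \in s -> (x < n.+1)%N.
  rewrite ltnS -s_sum; elim: s {s_gt0 s_sum le_size} => //= y s IHs.
  rewrite inE => /predU1P [-> | /IHs xs]; first exact: leq_addr.
  exact: leq_trans xs (leq_addl _ _).
have le_size' : (size (map (@inord n) s) <= n)%N by rewrite size_map.
apply/mapP; exists (Bseq le_size'); first by rewrite mem_enum.
rewrite /= -map_comp -[LHS]map_id; apply/eq_in_map => x /le_part lt_x /=.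
by rewrite inordK.
Qed.

(* Lexicographic order. Neither of two distinct partitions of the same n is a
   prefix of the other, so the convention on prefixes plays no role. *)
Definition partition_lt (lambda kappa : seq nat) : bool :=
  ((lambda : seqlexi nat) < (kappa : seqlexi nat))%O.

(* Parts are numbered from 1 in the formula, hence i.+1. *)
Definition rho (lambda : seq nat) : int :=
  \sum_(i < size lambda)
    (nth 0%N lambda i)%:Z * ((nth 0%N lambda i)%:Z - i.+1%:Z).

(* The sum runs over the exponent vectors that are rearrangements of lambda
   padded with zeros to length q, each counted once. If q < size lambda there
   are none and the sum is 0. *)
Definition monomial_symmetric (R : nzRingType) (q : nat) (lambda : seq nat) :
    {mpoly R[q]} :=
  \sum_(m : 'X_{1..q < (sumn lambda).+1}
        | perm_eq (multinom_val m) (lambda ++ nseq (q - size lambda) 0%N))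
    'X_[m].

(* The coefficients of the operator have denominators 'X_i - 'X_j, so it takes
   its values in the field of rational functions. *)
Definition zonal_operator (R : idomainType) (q : nat) (p : {mpoly R[q]}) :
    {fraction {mpoly R[q]}} :=
  \sum_(i < q)
    (tofrac ('X_i ^+ 2 * p^`M(i)^`M(i))
     + \sum_(j < q | j != i)
         tofrac ('X_i ^+ 2) / tofrac ('X_i - 'X_j) * tofrac p^`M(i)).

Definition zonal_polynomial (R : nzRingType) (n q : nat)
    (c : seq nat -> seq nat -> R) (kappa : seq nat) : {mpoly R[q]} :=
  \sum_(lambda <- partitions n | (lambda == kappa) || partition_lt lambda kappa)
    c kappa lambda *: monomial_symmetric R q lambda.

Definition is_zonal_coefficients (R : idomainType) (n q : nat)
    (c : seq nat -> seq nat -> R) : Prop :=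
  [/\ {in partitions n &, forall kappa lambda,
         partition_lt kappa lambda -> c kappa lambda = 0},
      {in partitions n &, forall kappa lambda,
         partition_lt lambda kappa -> rho kappa <= rho lambda ->
         c kappa lambda = 0},
      {in partitions n, forall kappa,
         zonal_operator (zonal_polynomial n q c kappa)
         = tofrac ((rho kappa + (q%:Z - 1) * n%:Z)%:~R
                   *: zonal_polynomial n q c kappa)}
    & \sum_(kappa <- partitions n) zonal_polynomial n q c kappa
      = (\sum_(i < q) 'X_i) ^+ n].

(* Main.v *)
Require Import Defs.
From HB Require Import structures.
From mathcomp Require Import all_boot all_order all_algebra.
From mathcomp Require Import mpoly ring zify.

Import Order.TTheory GRing.Theory Num.Theory.
Local Open Scope ring_scope.

(** Write p for the top zonal polynomial, in variables y_0, ..., y_(q-1), and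
    f b for its coefficient at y_0^(n-b) y_1^b. The eigenvalue equation,
    restricted to y_0 = 1, y_1 = s and all other variables 0, only involves the
    f b. After multiplication by 1 - s, comparing the coefficients of s^(b+1)
    gives the first-order recurrence
      f (b+1) (b+1) (2(n-b-1)+1) = f b (n-b) (2b+1)
    ([two_part_recurrence]). Since f 0 = 1 by the normalization
    ([zonal_coefficient_top]), the stated quotient of Pochhammer symbols follows
    by induction.

    The delicate point is the restriction: the denominators y_i - y_j with both
    variables sent to 0 vanish there. The equation is therefore followed along
    the curve y_i = x_i + i t, on which no y_i - y_j vanishes identically, and
    then t goes to 0. A quotient y_i^2 / (y_i - y_j) with x_i = x_j = 0 becomes
    i^2 t / (i - j), whose limit is 0. So the equation holds at x with the
    convention 0 / 0 = 0 ([zonal_operator_specialization]).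

    Two facts turn values into coefficients: y_i d/dy_i multiplies the
    coefficient of a monomial by the exponent of y_i, and a homogeneous
    polynomial of degree n takes at (1, s, 0, ..., 0) the value of the
    polynomial in s with coefficients f b ([meval_two_point]). *)

(** * Specialization of rational functions *)

(** The value, under psi, of a fraction that becomes u / w in the fraction field
    of D. The pair (u, w) is there to cancel a common factor of phi a and phi b
    that psi kills: with phi the substitution of a curve and psi the evaluation
    at its origin, r is the limit of F along the curve. *)
Definition specializes_to (A D : idomainType) (K : fieldType)
    (phi : {rmorphism A -> D}) (psi : {rmorphism D -> K})
    (F : {fraction A}) (r : K) : Prop :=
  exists a b u w,
    [/\ F * tofrac b = tofrac a, phi b != 0, phi a * w = phi b * u,
        psi w != 0 & psi u = r * psi w].

Section Specialization.
Variables (A D : idomainType) (K : fieldType).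
Variables (phi : {rmorphism A -> D}) (psi : {rmorphism D -> K}).
Local Notation spec := (specializes_to A D K phi psi).

Lemma specializes_tofrac a : spec (tofrac a) (psi (phi a)).
Proof.
exists a, 1, (phi a), 1; rewrite !rmorph1 !mulr1 mul1r.
by split; rewrite ?oner_neq0.
Qed.

Lemma specializes_div a b u w :
  phi b != 0 -> phi a * w = phi b * u -> psi w != 0 ->
  spec (tofrac a / tofrac b) (psi u / psi w).
Proof.
move=> b_neq0 abE w_neq0; exists a, b, u, w; split=> //; rewrite divfK //.
by rewrite tofrac_eq0; apply: contraNneq b_neq0 => ->; rewrite rmorph0.
Qed.

Lemma specializesD F G r s : spec F r -> spec G s -> spec (F + G) (r + s).
Proof.
move=> [a [b [u [w [Fb b0 abE w0 ur]]]]].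
move=> [a' [b' [u' [w' [Gb b0' abE' w0' ur']]]]].
exists (a * b' + a' * b), (b * b'), (u * w' + u' * w), (w * w').
rewrite !rmorphD !rmorphM !mulf_neq0 //; split=> //.
- by rewrite /= -Fb -Gb; ring.
- have -> : (phi a * phi b' + phi a' * phi b) * (w * w')
    = (phi a * w) * phi b' * w' + (phi a' * w') * phi b * w by ring.
  by rewrite abE abE'; ring.
- by rewrite ur ur'; ring.
Qed.

Lemma specializesM F G r s : spec F r -> spec G s -> spec (F * G) (r * s).
Proof.
move=> [a [b [u [w [Fb b0 abE w0 ur]]]]].
move=> [a' [b' [u' [w' [Gb b0' abE' w0' ur']]]]].
exists (a * a'), (b * b'), (u * u'), (w * w').
rewrite !rmorphM !mulf_neq0 //; split=> //.
- by rewrite /= -Fb -Gb; ring.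
- by rewrite mulrACA abE abE' mulrACA.
- by rewrite ur ur'; ring.
Qed.

Lemma specializes_sum (I : finType) (P : pred I) (F : I -> {fraction A}) r :
  (forall i, P i -> spec (F i) (r i)) ->
  spec (\sum_(i | P i) F i) (\sum_(i | P i) r i).
Proof.
move=> FP; apply: (big_rec2 (fun y x => spec x y)).
  by rewrite -(tofrac0 A) -(rmorph0 psi) -(rmorph0 phi);
     apply: specializes_tofrac.
by move=> i y x Pi; apply: specializesD; apply: FP.
Qed.

Lemma specializes_unique F r s : spec F r -> spec F s -> r = s.
Proof.
move=> [a [b [u [w [Fb b0 abE w0 ur]]]]].
move=> [a' [b' [u' [w' [Gb b0' abE' w0' ur']]]]].
have /(congr1 phi) : a * b' = a' * b.
  by apply/eqP; rewrite -tofrac_eq !tofracM -Fb -Gb; apply/eqP; ring.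
rewrite !rmorphM => eq_cross.
have /(mulfI (mulf_neq0 b0 b0')) /(congr1 psi) :
    phi b * phi b' * (u * w') = phi b * phi b' * (u' * w).
  have -> : phi b * phi b' * (u * w') = (phi b * u) * phi b' * w' by ring.
  have -> : phi b * phi b' * (u' * w) = (phi b' * u') * phi b * w by ring.
  rewrite -abE -abE'.
  have -> : phi a * w * phi b' * w' = (phi a * phi b') * w * w' by ring.
  by rewrite eq_cross; ring.
rewrite !rmorphM ur ur' => E.
by apply: (mulfI (mulf_neq0 w0 w0')); rewrite mulrC mulrA E; ring.
Qed.
End Specialization.

(** At a point whose coordinates may only coincide when they are 0, the zonal
    operator can be evaluated naively: for x i = x j = 0 the convention 0 / 0 = 0
    gives the limit of the corresponding quotient along x i + i t. *)
Lemma zonal_operator_specialization (R : numFieldType) (q : nat)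
    (p g : {mpoly R[q]}) (x : 'I_q -> R) :
  (forall i j, i != j -> x i = x j -> x i = 0) ->
  zonal_operator p = tofrac g ->
  \sum_(i < q)
    (x i ^+ 2 * p^`M(i)^`M(i).@[x]
     + \sum_(j < q | j != i) x i ^+ 2 / (x i - x j) * p^`M(i).@[x])
  = g.@[x].
Proof.
move=> x_inj pE.
pose curve i : {poly R} := (x i)%:P + i%:R *: 'X.
pose phi : {rmorphism {mpoly R[q]} -> {poly R}} := mmap polyC curve.
pose psi : {rmorphism {poly R} -> R} := horner_eval 0.
have phiX i : phi 'X_i = curve i by rewrite /phi /= mmapX mmap1U.
have curve0 i : (curve i).[0] = x i by rewrite /curve !hornerE.
have psi_phi (h : {mpoly R[q]}) : psi (phi h) = h.@[x].
  rewrite /psi /phi /= /meval /mmap horner_evalE horner_sum.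
  apply: eq_bigr => m _.
  rewrite hornerM hornerC /mmap1 horner_prod; congr (_ * _).
  by apply: eq_bigr => i _; rewrite horner_exp curve0.
apply: (specializes_unique _ _ _ phi psi (tofrac g)); last first.
  by rewrite -psi_phi; apply: specializes_tofrac.
rewrite -pE /zonal_operator; apply: specializes_sum => i _.
apply: specializesD.
  have -> : x i ^+ 2 * p^`M(i)^`M(i).@[x]
      = psi (phi ('X_i ^+ 2 * p^`M(i)^`M(i))).
    by rewrite psi_phi mevalM rmorphXn /= mevalXU.
  exact: specializes_tofrac.
apply: specializes_sum => j ji; apply: specializesM; last first.
  by rewrite -psi_phi; apply: specializes_tofrac.
have ij0 : i%:R - j%:R != 0 :> R.
  by rewrite subr_eq0 eqr_nat eq_sym; apply: contraNneq ji => /val_inj ->.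
have phi_diff : phi ('X_i - 'X_j) = (x i - x j)%:P + (i%:R - j%:R) *: 'X.
  by rewrite rmorphB !phiX /curve rmorphB /= scalerBl; ring.
have phi_diff_neq0 : phi ('X_i - 'X_j) != 0.
  rewrite phi_diff; apply/eqP => /(congr1 (fun h : {poly R} => h`_1)).
  by rewrite !coefE add0r mulr1 => /eqP; rewrite (negPf ij0).
have [xij|xij] := eqVneq (x i) (x j); last first.
  have -> : x i ^+ 2 / (x i - x j)
      = psi (phi ('X_i ^+ 2)) / psi (phi ('X_i - 'X_j)).
    by rewrite !psi_phi mevalB rmorphXn /= !mevalXU.
  apply: specializes_div => //; first by rewrite mulrC.
  by rewrite psi_phi mevalB !mevalXU subr_eq0.
have xi0 : x i = 0 by apply: (x_inj i j) xij; rewrite eq_sym.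
(* (i t)^2 / (i t - j t), reduced by the common factor t *)
have -> : x i ^+ 2 / (x i - x j)
    = psi (i%:R ^+ 2 *: 'X) / psi ((i%:R - j%:R)%:P).
  by rewrite xi0 /psi /= !horner_evalE !hornerE ?mulr0 expr0n !mul0r.
apply: specializes_div => //; last by rewrite /psi /= horner_evalE hornerC.
rewrite phi_diff -xij subrr rmorphXn /= mmapX mmap1U /curve xi0 !add0r.
by rewrite -!mul_polyC rmorphXn /=; ring.
Qed.

(** * Restriction to two variables *)

Lemma mcoeff_XMderiv (R : nzRingType) (q : nat) (p : {mpoly R[q]}) i m :
  ('X_i * p^`M(i))@_m = p@_m *+ m i.
Proof.
rewrite -commr_mpolyX; case mi: (m i) => [|d].
  rewrite [p^`M(i)]mpolyE mulr_suml raddf_sum big1 //= => m' _.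
  rewrite -scalerAl -mpolyXD mcoeffZ mcoeffX.
  case: eqP => [E|_]; last exact: mulr0.
  by move: mi; rewrite -E mnmDE mnm1E eqxx addn1.
have U_le_m : (U_(i) <= m)%MM.
  by apply/mnm_lepP => j; rewrite mnm1E; case: eqP => // <-; rewrite mi.
rewrite -[in LHS](submK U_le_m) addmC mcoeffMX mcoeff_deriv submK //.
by rewrite mnmBE mnm1E eqxx mi subn1.
Qed.

Lemma mcoeff_X2Mderiv2 (R : comNzRingType) (q : nat) (p : {mpoly R[q]}) i m :
  ('X_i ^+ 2 * p^`M(i)^`M(i))@_m = p@_m *+ (m i * (m i).-1).
Proof.
have -> : 'X_i ^+ 2 * p^`M(i)^`M(i)
    = 'X_i * ('X_i * p^`M(i))^`M(i) - 'X_i * p^`M(i).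
  rewrite mderivM mderivX mnm1E eqxx scale1r -[X in 'X_[X - _]]add0m addmK.
  by rewrite mpolyX0 mul1r mulrDr mulrA -expr2 addrAC subrr add0r.
rewrite mcoeffB !mcoeff_XMderiv -mulrnA.
case: (m i) => [|d] /=; first by rewrite !mulr0n subr0.
by rewrite mulnSr mulrnDr addrK.
Qed.

Definition two_part (q n b : nat) : 'X_{1..q} :=
  [multinom nth 0%N [:: n - b; b]%N i | i < q].

Definition two_point (R : nzRingType) (q : nat) (s : R) (i : 'I_q) : R :=
  [:: 1; s]`_i.

Lemma two_part_inj q n : injective (two_part q.+2 n).
Proof. by move=> b b' /mnmP /(_ (lift ord0 ord0)); rewrite !mnmE. Qed.

Lemma two_partP k n (m : 'X_{1..k.+2}) : mdeg m = n ->
  (forall i : 'I_k, m (lift ord0 (lift ord0 i)) = 0%N) ->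
  m = two_part k.+2 n (m (lift ord0 ord0)).
Proof.
rewrite mdegE !big_ord_recl => mn m0; move: mn.
rewrite big1 ?addn0 => [mn|i _]; last exact: m0.
apply/mnmP => i; rewrite mnmE.
case: (unliftP ord0 i) => [i' ->|->] /=; last by rewrite -mn addnK.
by case: (unliftP ord0 i') => [i'' ->|->] //=; rewrite m0 nth_nil.
Qed.

(** At most one term of the sum is nonzero; it is written as a sum to be
    exchanged with the sum over the monomials of a polynomial. *)
Lemma mmap1_two_point (R : comNzRingType) k n (s : R) (m : 'X_{1..k.+2}) :
  mdeg m = n ->
  mmap1 (two_point R k.+2 s) m
  = \sum_(b < n.+1) (m == two_part k.+2 n b)%:R * s ^+ b.
Proof.
move=> mn; rewrite /mmap1 big_ord_recl [X in _ * X]big_ord_recl /=.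
rewrite expr1n mul1r.
have [/forallP /= m0 | /forallPn /= [i mi]] :=
    boolP [forall i : 'I_k, m (lift ord0 (lift ord0 i)) == 0%N]; last first.
  rewrite (bigD1 i) //= /two_point /= nth_nil expr0n (negPf mi) mul0r mulr0.
  rewrite big1 // => b _; case: eqP => [E|_]; last exact: mul0r.
  by move: mi; rewrite E mnmE /= nth_nil.
have mE := two_partP _ _ _ mn (fun i => eqP (m0 i)).
have lt_m : (m (lift ord0 ord0) < n.+1)%N.
  by rewrite ltnS -mn mdegE (bigD1 (lift ord0 ord0)) //= leq_addr.
rewrite (bigD1 (Ordinal lt_m)) //= -mE eqxx mul1r.
rewrite [X in _ * X]big1 ?mulr1 => [|i _]; last by rewrite (eqP (m0 i)).
rewrite [X in _ + X]big1 ?addr0 //= => b ne_b; rewrite {1}mE.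
case: eqP => [/two_part_inj E|_]; last exact: mul0r.
by case/eqP: ne_b; apply: val_inj; rewrite /= -E.
Qed.

Lemma meval_two_point (R : comNzRingType) k n (s : R) (p : {mpoly R[k.+2]}) :
  p \is n.-homog ->
  p.@[two_point R k.+2 s]
  = (\poly_(b < n.+1) p@_(two_part k.+2 n b)).[s].
Proof.
move=> /dhomogP p_hom; rewrite /meval /mmap horner_poly.
under eq_big_seq => m pm do
  rewrite (mmap1_two_point _ _ n) ?(p_hom _ pm) // mulr_sumr.
rewrite exchange_big /=; apply: eq_bigr => b _.
rewrite [X in _ = X@__ * _]mpolyE raddf_sum mulr_suml; apply: eq_bigr => m _ /=.
by rewrite mcoeffZ mcoeffX mulrA.
Qed.

Lemma poly_eq0_of_nat_roots (R : numDomainType) (h : {poly R}) :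
  (forall d, h.[d.+2%:R] = 0) -> h = 0.
Proof.
move=> h0; apply/eqP/negPn/negP => h_neq0.
have := max_poly_roots h_neq0 (rs := [seq d.+2%:R | d <- iota 0 (size h)]).
rewrite size_map size_iota ltnn => F; apply: notF; apply: F.
  by apply/allP => _ /mapP [d _ ->]; apply/eqP.
by rewrite map_inj_uniq ?iota_uniq // => d e /eqP; rewrite eqr_nat => /eqP [].
Qed.

(** At (1, s, 0, ..., 0), each of the k vanishing variables contributes
    y_0 d/dy_0 + y_1 d/dy_1, and the pair of the first two contributes
    (y_0 d/dy_0 - s y_1 d/dy_1) / (1 - s). *)
Lemma two_variable_equation (R : numFieldType) k (p g : {mpoly R[k.+2]})
    (s : R) :
  zonal_operator p = tofrac g -> s != 1 ->
  let val (h : {mpoly R[k.+2]}) := h.@[two_point R k.+2 s] in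
  let i0 := ord0 in let i1 := lift ord0 ord0 in
  (1 - s) * (val ('X_i0 ^+ 2 * p^`M(i0)^`M(i0))
             + val ('X_i1 ^+ 2 * p^`M(i1)^`M(i1))
             + k%:R * (val ('X_i0 * p^`M(i0)) + val ('X_i1 * p^`M(i1)))
             - val g)
  + val ('X_i0 * p^`M(i0)) - s * val ('X_i1 * p^`M(i1)) = 0.
Proof.
move=> pE s1 val i0 i1; rewrite /val.
set x := two_point R k.+2 s.
have s1' : 1 - s != 0 by rewrite subr_eq0 eq_sym.
have s1'' : s - 1 != 0 by rewrite subr_eq0.
have x0 : x i0 = 1 by [].
have x1 : x i1 = s by [].
have x2 (j : 'I_k) : x (lift ord0 (lift ord0 j)) = 0.
  by rewrite /x /two_point /= nth_nil.
have x_inj i j : i != j -> x i = x j -> x i = 0.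
  case: i j => [[|[|i]] hi] [[|[|j]] hj]; rewrite /x /two_point /= ?nth_nil //.
  - by move=> _ E; move: s1; rewrite E eqxx.
  - by move=> _ E; move: s1; rewrite E eqxx.
have := zonal_operator_specialization _ _ p g x x_inj pE.
have eval1 i (h : {mpoly R[k.+2]}) : ('X_i * h).@[x] = x i * h.@[x].
  by rewrite mevalM mevalXU.
have eval2 i (h : {mpoly R[k.+2]}) : ('X_i ^+ 2 * h).@[x] = x i ^+ 2 * h.@[x].
  by rewrite mevalM rmorphXn /= mevalXU.
rewrite big_ord_recl [X in _ + X]big_ord_recl.
rewrite [X in _ + (_ + X)]big1 => [|j _]; last first.
  by rewrite x2 expr0n mul0r big1 ?addr0 // => i _; rewrite !mul0r.
have sum_from0 :
    \sum_(j < k.+2 | j != i0) x i0 ^+ 2 / (x i0 - x j) * p^`M(i0).@[x]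
    = ((1 - s)^-1 + k%:R) * p^`M(i0).@[x].
  rewrite big_mkcond 2!big_ord_recl /= add0r.
  under eq_bigr => j _ do rewrite x2 x0 subr0 expr1n divr1 mul1r.
  by rewrite sumr_const card_ord x0 x1 expr1n mul1r mulrDl mulr_natl.
have sum_from1 :
    \sum_(j < k.+2 | j != i1) x i1 ^+ 2 / (x i1 - x j) * p^`M(i1).@[x]
    = (s / (s - 1) + k%:R) * (s * p^`M(i1).@[x]).
  rewrite big_mkcond 2!big_ord_recl /= add0r.
  under eq_bigr => j _ do rewrite x2 x1 subr0.
  rewrite sumr_const card_ord x0 x1 -mulr_natl.
  have -> : s ^+ 2 / s = s.
    by have [->|s_neq0] := eqVneq s 0; rewrite ?expr0n ?mul0r // expr2 mulfK.
  by field.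
rewrite sum_from0 sum_from1 !eval2 !eval1 x0 x1 => <-; field.
by rewrite s1' s1''.
Qed.

(** * The recurrence and its solution *)

(** The eigenvalue n (n - 1) + (q - 1) n of the one-part partition, with
    q = k + 2 variables, is n^2 + k n. *)
Lemma two_part_recurrence (R : numFieldType) k n (p : {mpoly R[k.+2]}) b :
  p \is n.-homog ->
  zonal_operator p = tofrac ((n * n + k * n)%:R *: p) -> (b < n)%N ->
  p@_(two_part k.+2 n b.+1) * (b.+1 * (2 * (n - b.+1)).+1)%:R
  = p@_(two_part k.+2 n b) * ((n - b) * (2 * b).+1)%:R.
Proof.
move=> /dhomogP p_hom pE lt_bn.
pose i0 : 'I_k.+2 := ord0; pose i1 : 'I_k.+2 := lift ord0 ord0.
pose sec (h : {mpoly R[k.+2]}) := \poly_(d < n.+1) h@_(two_part k.+2 n d).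
pose ev (h : {mpoly R[k.+2]}) (s : R) := h.@[two_point R k.+2 s].
have secE (h : {mpoly R[k.+2]}) (e : 'X_{1..k.+2} -> nat) s :
    (forall m, h@_m = p@_m *+ e m) -> ev h s = (sec h).[s].
  move=> hE; apply/meval_two_point/dhomogP => m.
  rewrite mcoeff_msupp hE => hm; apply: p_hom; rewrite mcoeff_msupp.
  by apply: contraNneq hm => ->; rewrite mul0rn.
have X1 i s := secE ('X_i * p^`M(i)) _ s (mcoeff_XMderiv _ _ p i).
have X2 i s :=
  secE ('X_i ^+ 2 * p^`M(i)^`M(i)) _ s (mcoeff_X2Mderiv2 _ _ p i).
have Xg s : ev ((n * n + k * n)%:R *: p) s
    = (sec ((n * n + k * n)%:R *: p)).[s].
  by apply: secE => m; rewrite mcoeffZ mulr_natl.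
have /(congr1 (fun h : {poly R} => h`_b.+1)) :
    (1 - 'X) * (sec ('X_i0 ^+ 2 * p^`M(i0)^`M(i0))
                + sec ('X_i1 ^+ 2 * p^`M(i1)^`M(i1))
                + k%:R%:P * (sec ('X_i0 * p^`M(i0)) + sec ('X_i1 * p^`M(i1)))
                - sec ((n * n + k * n)%:R *: p))
    + sec ('X_i0 * p^`M(i0)) - 'X * sec ('X_i1 * p^`M(i1)) = 0.
  apply: poly_eq0_of_nat_roots => d.
  have d_neq1 : d.+2%:R != 1 :> R by rewrite -[1]/(1%:R) eqr_nat.
  have := two_variable_equation _ _ _ _ _ pE d_neq1.
  rewrite /= -!/(ev _ _) -/i0 -/i1 !X1 !X2 Xg => <-.
  by rewrite !(hornerD, hornerN, hornerM, hornerX, hornerC).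
rewrite mulrBl mul1r !(coefD, coefN, coefXM, coefCM) /= !coef_poly.
rewrite !ltnS lt_bn (ltnW lt_bn).
rewrite !mcoeff_X2Mderiv2 !mcoeff_XMderiv !mcoeffZ !mnmE /=.
have [d ->] : exists d, n = (b + d.+1)%N.
  by exists (n - b.+1)%N; rewrite addnS -addSn subnKC.
rewrite addKn -addSnnS addKn.
move: (p@_ _) (p@_ _) => f f' E.
have nat_pred e : (e * e.-1)%:R = e%:R * (e%:R - 1) :> R.
  by case: e => [|e] /=; rewrite ?mul0n ?mul0r // natrM -(natr1 e) addrK.
move: E; rewrite coef0 -!(mulr_natr f) -!(mulr_natr f') !nat_pred => E.
apply/eqP; rewrite -subr_eq0 -oppr_eq0; apply/eqP; rewrite -[RHS]E.
by clear; ring.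
Qed.

Lemma two_part_closed_form (R : numFieldType) k n (p : {mpoly R[k.+2]}) m :
  p \is n.-homog ->
  zonal_operator p = tofrac ((n * n + k * n)%:R *: p) -> (m <= n)%N ->
  p@_(two_part k.+2 n m)
  = p@_(two_part k.+2 n 0)
    * ('C(n, m)%:R * (pochhammer (1 / 2%:R) m
                      / pochhammer (n%:R - m%:R + 1 / 2%:R) m)).
Proof.
move=> p_hom pE; elim: m => [|b IHb] lt_bn.
  by rewrite bin0 /pochhammer !big_ord0 divr1 !mulr1.
have {}IHb := IHb (ltnW lt_bn).
have rec := two_part_recurrence _ _ _ _ _ p_hom pE lt_bn.
have half_gt0 : 0 < 1 / 2%:R :> R by rewrite divr_gt0 ?ltr0n.
have denom_neq0 : pochhammer (n%:R - b%:R + 1 / 2%:R : R) b != 0.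
  apply/prodf_neq0 => i _; rewrite gt_eqF // ltr_wpDr ?ler0n // ltr_wpDl //.
  by rewrite subr_ge0 ler_nat ltnW.
have num_step : pochhammer (1 / 2%:R : R) b.+1
    = pochhammer (1 / 2%:R) b * (1 / 2%:R + b%:R).
  by rewrite /pochhammer big_ord_recr.
have denom_step : pochhammer (n%:R - b.+1%:R + 1 / 2%:R : R) b.+1
    = (n%:R - b.+1%:R + 1 / 2%:R) * pochhammer (n%:R - b%:R + 1 / 2%:R) b.
  rewrite /pochhammer big_ord_recl addr0; congr (_ * _).
  by apply: eq_bigr => i _ /=; rewrite /bump /= add1n -!natr1; ring.
have binE : 'C(n, b.+1)%:R = 'C(n, b)%:R * (n - b)%:R / b.+1%:R :> R.
  apply: (mulIf (_ : b.+1%:R != 0)); rewrite ?pnatr_eq0 //.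
  by rewrite divfK ?pnatr_eq0 // -!natrM mulnC mul_bin_left mulnC.
rewrite num_step denom_step binE.
have sub_neq0 : (2 * (n - b.+1)).+1%:R != 0 :> R by rewrite pnatr_eq0.
have half_shift :
    n%:R - b.+1%:R + 1 / 2%:R = (2 * (n - b.+1)).+1%:R / 2%:R :> R.
  by rewrite -natrB // -[(2 * _).+1%:R]natr1 natrM; field.
rewrite half_shift.
have b1_neq0 : b.+1%:R != 0 :> R by rewrite pnatr_eq0.
apply: (mulIf (_ : (b.+1 * (2 * (n - b.+1)).+1)%:R != 0)).
  by rewrite natrM mulf_neq0.
rewrite rec IHb !natrM -[(2 * b).+1%:R]natr1 natrM.
move: denom_neq0 sub_neq0 b1_neq0.
move: (pochhammer _ b) ((2 * (n - b.+1)).+1%:R : R) (b.+1%:R).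
by move=> P Q S P0 Q0 S0; field; apply/and3P.
Qed.

(** * Coefficients of zonal polynomials *)

Lemma mcoeff_monomial_symmetric (R : nzRingType) q lambda (m : 'X_{1..q}) :
  (monomial_symmetric R q lambda)@_m
  = (perm_eq (multinom_val m) (lambda ++ nseq (q - size lambda) 0%N))%:R.
Proof.
rewrite /monomial_symmetric raddf_sum /=.
under eq_bigr => m' _ do rewrite mcoeffX.
case m_perm: (perm_eq _ _); last first.
  by rewrite big1 // => m' Pm'; case: eqP => // E; rewrite -E Pm' in m_perm.
have lt_m : (mdeg m < (sumn lambda).+1)%N.
  by rewrite /mdeg (perm_big _ m_perm) -sumnE sumn_cat sumn_nseq mul0n addn0.
rewrite (bigD1 (Sub m lt_m)) //= eqxx big1 ?addr0 // => m' /andP [_ ne_m'].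
by case: eqP => // E; case/eqP: ne_m'; apply: val_inj.
Qed.

Lemma partition_padding_inj n lambda mu a b :
  lambda \in partitions n -> mu \in partitions n ->
  perm_eq (lambda ++ nseq a 0%N) (mu ++ nseq b 0%N) -> lambda = mu.
Proof.
rewrite !mem_partitions => /and3P [sl pl _] /and3P [sm pm _].
move=> /(perm_filter (fun d => 0 < d)%N).
rewrite !filter_cat (all_filterP pl) (all_filterP pm) !filter_nseq /= !cats0.
have geq_trans : transitive geq by move=> y x z xy yz; apply: leq_trans yz xy.
apply: (sorted_eq geq_trans) => //.
by move=> x y; rewrite /geq /= andbC; apply: anti_leq.
Qed.

Lemma mcoeff_zonal_polynomial (R : nzRingType) n q c kappa mu (m : 'X_{1..q}) :
  mu \in partitions n ->
  perm_eq (multinom_val m) (mu ++ nseq (q - size mu) 0%N) ->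
  (zonal_polynomial n q c kappa : {mpoly R[q]})@_m
  = if (mu == kappa) || partition_lt mu kappa then c kappa mu else 0.
Proof.
move=> mu_n m_mu; rewrite /zonal_polynomial raddf_sum /= big_mkcond.
rewrite (bigD1_seq mu) ?partitions_uniq //=.
rewrite [X in _ + X]big1_seq => [|lambda].
  rewrite addr0; case: ifP => // _.
  by rewrite mcoeffZ mcoeff_monomial_symmetric m_mu mulr1.
case/andP=> ne lambda_n; case: ifP => // _.
rewrite mcoeffZ mcoeff_monomial_symmetric.
case m_lambda: (perm_eq _ _); last exact: mulr0.
case/eqP: ne; apply: (partition_padding_inj _ _ _ _ _ lambda_n mu_n).
by rewrite perm_sym in m_lambda; apply: perm_trans m_lambda m_mu.
Qed.

Lemma zonal_polynomial_homogeneous (R : nzRingType) n q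
    (c : seq nat -> seq nat -> R) kappa :
  zonal_polynomial n q c kappa \is n.-homog.
Proof.
apply/dhomogP => m; rewrite mcoeff_msupp; apply: contraNeq => m_n; apply/eqP.
rewrite /zonal_polynomial raddf_sum /= big1_seq // => lambda /andP [_].
rewrite mem_partitions => /and3P [_ _ /eqP lambda_n].
rewrite mcoeffZ mcoeff_monomial_symmetric.
case m_perm: (perm_eq _ _); last exact: mulr0.
case/eqP: m_n; rewrite /= /mdeg (perm_big _ m_perm) -sumnE sumn_cat sumn_nseq.
by rewrite mul0n addn0.
Qed.

Lemma two_partE k n b :
  (two_part k.+2 n b : seq nat) = [:: n - b; b]%N ++ nseq k 0%N.
Proof.
apply: (@eq_from_nth _ 0%N); rewrite size_tuple ?size_cat ?size_nseq //.
move=> i lt_i.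
have -> : nth 0%N (two_part k.+2 n b) i = two_part k.+2 n b (Ordinal lt_i).
  by rewrite multinomE (tnth_nth 0%N).
rewrite mnmE; case: i lt_i => [|[|i]] //= _.
by rewrite nth_nil nth_nseq; case: ifP.
Qed.

Lemma one_part_in n : (0 < n)%N -> [:: n] \in partitions n.
Proof. by move=> n0; rewrite mem_partitions /is_partition /= n0 addn0 eqxx. Qed.

Lemma one_part_maximal n kappa : kappa \in partitions n ->
  partition_lt [:: n] kappa = false.
Proof.
rewrite mem_partitions => /and3P [_ pos /eqP kn]; apply/negP.
rewrite /partition_lt; case: kappa pos kn => [|x [|y s]] //=.
  by rewrite addn0 => _ ->; rewrite ltxx.
move=> /and3P [_ y0 _] kn; rewrite ltxi_cons => /andP [].
by rewrite leEnat; lia.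
Qed.

(** The normalization, evaluated at (1, 0, ..., 0): only the top zonal polynomial
    has a monomial y_0^n. *)
Lemma zonal_coefficient_top (R : idomainType) n k c :
  (0 < n)%N -> is_zonal_coefficients n k.+2 (c : seq nat -> seq nat -> R) ->
  c [:: n] [:: n] = 1.
Proof.
move=> n0 [_ _ _ csum].
have top_perm : perm_eq (multinom_val (two_part k.+2 n 0))
    ([:: n] ++ nseq (k.+2 - size [:: n]) 0%N) by rewrite two_partE subn0.
have evalE kappa :
    (zonal_polynomial n k.+2 c kappa).@[two_point R k.+2 0]
    = if ([:: n] == kappa) || partition_lt [:: n] kappa
      then c kappa [:: n] else 0.
  rewrite (meval_two_point _ _ n); last exact: zonal_polynomial_homogeneous.
  rewrite horner_coef0 coef_poly /=.
  by rewrite (mcoeff_zonal_polynomial _ _ _ _ _ [:: n]) ?one_part_in.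
have := congr1 (fun h : {mpoly R[k.+2]} => h.@[two_point R k.+2 0]) csum.
have -> : ((\sum_(i < k.+2) 'X_i) ^+ n : {mpoly R[k.+2]}).@[two_point R k.+2 0]
    = 1.
  rewrite rmorphXn /= raddf_sum /= 2!big_ord_recl !mevalXU big1 => [|i _].
    by rewrite /two_point /= !addr0 expr1n.
  by rewrite mevalXU /two_point /= nth_nil.
rewrite raddf_sum /= => <-.
rewrite (bigD1_seq [:: n]) ?partitions_uniq ?one_part_in //= evalE eqxx /=.
rewrite big1_seq ?addr0 // => kappa /andP [ne kappa_n].
by rewrite evalE eq_sym (negPf ne) one_part_maximal.
Qed.

Theorem theorem5p1 (R : realFieldType) (n m q : nat)
    (c : seq nat -> seq nat -> R)
    (hq : (n <= q)%N)
    (hc : is_zonal_coefficients n q c)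
    (hnm : [:: (n - m)%N; m] \in partitions n) :
  c [:: n] [:: (n - m)%N; m]
  = 'C(n, m)%:R
    * (pochhammer (1 / 2%:R) m / pochhammer (n%:R - m%:R + 1 / 2%:R) m).
Proof.
have /and3P [_ pos _] : is_partition n [:: (n - m)%N; m].
  by rewrite -mem_partitions.
have [m_lt_n m0] : (m < n)%N /\ (0 < m)%N.
  by move: pos; rewrite /= subn_gt0 andbT => /andP.
have n0 : (0 < n)%N by apply: leq_trans m_lt_n.
case: q hq hc => [|[|k]] hq hc; [lia | lia |].
set p : {mpoly R[k.+2]} := zonal_polynomial n k.+2 c [:: n].
have p_hom : p \is n.-homog by apply: zonal_polynomial_homogeneous.
have top_eigenvalue :
    (rho [:: n] + (k.+2%:Z - 1) * n%:Z)%:~R = (n * n + k * n)%:R :> R.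
  by rewrite /rho big_ord_recl big_ord0 /= -[RHS]mulrz_nat; congr (_ %:~R); lia.
have pE : zonal_operator p = tofrac ((n * n + k * n)%:R *: p).
  by case: (hc) => _ _ /(_ _ (one_part_in n n0)) -> _; rewrite top_eigenvalue.
have mE := mcoeff_zonal_polynomial R n k.+2 c [:: n].
have c_m : p@_(two_part k.+2 n m) = c [:: n] [:: (n - m)%N; m].
  rewrite /p (mE [:: (n - m)%N; m]) //; last by rewrite two_partE /= subn2.
  rewrite /partition_lt ltxi_cons leEnat leq_subr leqNgt ltn_subrL m0 n0.
  by rewrite orbT.
have c_0 : p@_(two_part k.+2 n 0) = 1.
  rewrite /p (mE [:: n]) ?one_part_in ?eqxx //.
    exact: zonal_coefficient_top hc.
  by rewrite two_partE subn0.
have := two_part_closed_form _ _ _ _ _ p_hom pE (ltnW m_lt_n).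
by rewrite c_m c_0 => ->; apply: mul1r.
Qed.
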